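(* Let $z\in\mathbb{R}^d$, let $f:\mathbb{R}^d\to\mathbb{R}^d$ be analytic in a neighbourhood of $z$, and let $w:\mathbb{T}\to\mathbb{R}^d$ (a fixed noise sample path) be analytic in a neighbourhood of $0$, where $\mathbb{T}\subset\mathbb{R}$ is an open interval containing $0$. Let $\mathrm{x}_0^{(0)}=z$ and recursively $$\mathrm{x}_0^{(n+1)}=\mathrm{f}^{(n)}\big(\mathrm{x}_0^{(0)},\dots,\mathrm{x}_0^{(n)}\big)+\frac{d^n}{dt^n}w_t\Big|_{t=0},\qquad n\ge 0.$$ Then there is $R>0$ such that the initial value problem $\frac{d}{dt}x_t=f(x_t)+w_t$, $x_0=z$, has a unique solution $x$ on $(-R,R)$ and $$\sum_{n=0}^\infty \mathrm{x}_0^{(n)}\frac{t^n}{n!}=\sum_{n=0}^\infty \frac{d^n}{dt^n}x_t\Big|_{t=0}\frac{t^n}{n!}=x_t\qquad\text{for all }t\in(-R,R).$$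
   Context: The functions $\mathrm{f}^{(n)}:(\mathbb{R}^d)^{n+1}\to\mathbb{R}^d$ (components of the generalised flow) are the expressions obtained from the chain rule such that $\mathrm{f}^{(n)}\big(x_t,\frac{d}{dt}x_t,\dots,\frac{d^n}{dt^n}x_t\big)=\frac{d^n}{dt^n}f(x_t)$ along smooth curves $x_t$; equivalently $\mathrm{f}^{(n)}(z^{(0)},\dots,z^{(n)})=\frac{d^n}{ds^n}\big|_{s=0} f\big(\sum_{k=0}^n z^{(k)}s^k/k!\big)$. The series $\mathrm{x}^{(0)}_t=\sum_n\mathrm{x}^{(n)}_0t^n/n!$ is the zeroth-order component of the solution of the generalised-coordinate system of infinite order. *)

(* Defs.v *)
From HB Require Import structures.
From mathcomp Require Import all_boot all_order all_algebra.
From mathcomp Require Import all_classical all_reals all_analysis.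
From mathcomp.analysis.showcase Require summability.

Set Implicit Arguments.
Unset Strict Implicit.
Unset Printing Implicit Defensive.

Import Order.TTheory GRing.Theory Num.Theory.
Import numFieldNormedType.Exports.

Local Open Scope classical_set_scope.
Local Open Scope ring_scope.

(* h^alpha = h_1^alpha_1 ... h_m^alpha_m *)
Definition monomial (R : realType) (m : nat)
    (alpha : {ffun 'I_m -> nat}) (h : 'rV[R]_m) : R :=
  \prod_(i < m) h ord0 i ^+ alpha i.

(* The sum over multi-indices is unconditional: the limit, along the directed
   set of finite sets of multi-indices, of the finite partial sums.  The norm
   on 'rV_m is the sup norm, so convergence is required on an open cube. *)
Definition analytic_at (R : realType) (m n : nat)
    (f : 'rV[R]_m -> 'rV[R]_n) (p : 'rV[R]_m) : Prop :=
  exists (c : {ffun 'I_m -> nat} -> 'rV[R]_n) (r : R), 0 < r /\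
    forall y, `|y - p| < r ->
      summability.partial_sum (fun alpha => monomial alpha (y - p) *: c alpha)
        @ summability.totally --> f y.

Definition analytic_curve_at (R : realType) (n : nat)
    (w : R -> 'rV[R]_n) (p : R) : Prop :=
  exists (c : nat -> 'rV[R]_n) (r : R), 0 < r /\
    forall t, `|t - p| < r ->
      series (fun k => (t - p) ^+ k *: c k) @ \oo --> w t.

(* Total in [f]: only the germ of [f] at [zs ord0] matters, and the value is
   meaningful when [f] is [n] times differentiable near that point. *)
Definition gen_flow (R : realType) (d : nat) (f : 'rV[R]_d -> 'rV[R]_d)
    (n : nat) (zs : 'I_n.+1 -> 'rV[R]_d) : 'rV[R]_d :=
  derive1n n (fun s : R => f (\sum_(k < n.+1) (s ^+ k / k`!%:R) *: zs k)) 0.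

(* Functions on ]-r, r[ are represented by total functions on R, whose values
   outside ]-r, r[ are irrelevant. *)
Definition ivp_solution (R : realType) (d : nat) (f : 'rV[R]_d -> 'rV[R]_d)
    (w : R -> 'rV[R]_d) (z : 'rV[R]_d) (r : R) (x : R -> 'rV[R]_d) : Prop :=
  x 0 = z /\
  forall t : R, t \in `]- r, r[ -> is_derive t 1 x (f (x t) + w t).

(* Main.v *)
Require Import Defs.
From HB Require Import structures.
From mathcomp Require Import all_boot all_order all_algebra finmap.
From mathcomp Require Import all_classical all_reals all_analysis.
From mathcomp Require Import ring lra.
From mathcomp.analysis.showcase Require summability.

Set Implicit Arguments.
Unset Strict Implicit.
Unset Printing Implicit Defensive.

Import Order.TTheory GRing.Theory Num.Theory.
Import numFieldNormedType.Exports.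

Local Open Scope classical_set_scope.
Local Open Scope ring_scope.

(** Put [a n = xi n / n!].  The idea is that the recursion on [xi] says exactly
    that the formal power series [sum_n a_n t^n] solves [x' = f(x) + w], and
    that one a priori estimate makes this formal solution converge.

    Expand [f (z + h) = sum_alpha c_alpha h^alpha].  Unconditional convergence
    at a corner of the cube [|h| <= rho] gives a bound [M] on the sums
    [sum_alpha |c_alpha| rho^|alpha|] ([analytic_majorized]).  For a polynomial
    curve [H] with [H(0) = 0], the coefficient of [s^n] in [f (z + H(s))] is a
    finite sum [comp_coef c H n].  The norm [pnorm r p = sum_k |p_k| r^k] is
    submultiplicative, so if the coordinates of [H] have norm at most [rho],
    then [sum_n |comp_coef c H n| r^n <= M] ([comp_coef_sum_le]) and the Taylor
    remainder of order [N] of [f (z + H(s))] is at most [(|s| / r)^N M]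
    ([comp_tail_le]).

    These two estimates enter in three places.
    - A polynomial vanishing at [0] has small norm when [r] is small, so
      [f (z + H(s))] is a power series near [0] and its [n]-th derivative, the
      generalised flow, is [n! * comp_coef] ([gen_flow_comp_coef]).  Hence
      [(n + 1) a_(n+1) = comp_coef c H_n n + b_n], where [H_n] is the curve
      [sum_(1 <= k <= n) a_k t^k] and [b] is the coefficient sequence of [w].
    - If [sum_(1 <= k <= N) |a_k| r^k <= sigma <= rho], then summing this
      relation against [r^(n+1)] bounds the next partial sum by [r (M + W)],
      where [W] bounds [sum_n |b_n| r^n].  For [r (M + W) <= sigma] the bound
      propagates by induction, so the series converges on [|t| < r]
      ([formal_solution_bound]).
    - The derivative of the [N]-th partial sum differs from
      [f (z + H_N(t)) + w(t)] by a quantity that tends to [0], and [f] is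
      Lipschitz near [z] ([analytic_lipschitz]), so the sum of the series
      solves the equation ([formal_solution_ode]).

    Uniqueness among all differentiable solutions follows from the Lipschitz
    bound and the connectedness of the interval ([ivp_unique]). *)

(** * Norm and convergence of row vectors *)

Lemma ler_rV_norm (R : realType) (n : nat) (v : 'rV[R]_n) (e : R) :
  0 <= e -> (forall i, `|v ord0 i| <= e) -> `|v| <= e.
Proof.
move=> e0 ve; rewrite /Num.Def.normr/= mx_normrE.
by apply: bigmax_le => // -[i j] _ /=; rewrite ord1.
Qed.

Lemma ler_norm_coord (R : realType) (n : nat) (v : 'rV[R]_n) i :
  `|v ord0 i| <= `|v|.
Proof.
by rewrite [leRHS]/Num.Def.normr/= mx_normrE; exact: (le_bigmax _ _ (ord0, i)).
Qed.

Lemma cvg_coord (R : realType) (n : nat) (T : Type) (F : set_system T)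
    {FF : Filter F} (u : T -> 'rV[R]_n) (l : 'rV[R]_n) i :
  u @ F --> l -> (fun x => u x ord0 i) @ F --> l ord0 i.
Proof. by move=> ul; exact: (cvg_comp _ _ ul (@coord_continuous _ _ _ _ _ l)). Qed.

Lemma cvg_rV (R : realType) (n : nat) (T : Type) (F : set_system T)
    {FF : Filter F} (u : T -> 'rV[R]_n) (l : 'rV[R]_n) :
  (forall i, (fun x => u x ord0 i) @ F --> l ord0 i) -> u @ F --> l.
Proof.
move=> ul; apply/cvgrPdist_le => e e0.
have : \forall x \near F, forall i, `|l ord0 i - u x ord0 i| <= e.
  by apply: filter_forall => i; exact: (cvgrPdist_le _ _).1 (ul i) e e0.
apply: filterS => x lu; apply: ler_rV_norm (ltW e0) _ => i.
by rewrite !mxE.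
Qed.

Lemma cvg_dist_le (R : realType) (V : normedModType R) (T : Type)
    (F : set_system T) {FF : ProperFilter F} (u : T -> V) (l v : V) (e : R) :
  u @ F --> l -> (\forall x \near F, `|u x - v| <= e) -> `|l - v| <= e.
Proof.
move=> ul uv.
have : (fun x => `|u x - v|) @ F --> `|l - v|.
  by apply: cvg_norm; apply: cvgB ul (cvg_cst _).
move=> h; apply: (closed_cvg (fun y : R => y <= e)) uv _ h.
exact: closed_le.
Qed.

Lemma series_coord (R : realType) (n : nat) (u : nat -> 'rV[R]_n) N i :
  series u N ord0 i = series (fun k => u k ord0 i) N.
Proof. by rewrite /series /= summxE. Qed.

Lemma series_scale_coord (R : realType) (n : nat) (a : nat -> 'rV[R]_n) (t : R) i :
  (fun N => series (fun k => t ^+ k *: a k) N ord0 i) =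
  pseries (fun k => a k ord0 i) t.
Proof.
apply/funext => N; rewrite series_coord /pseries /series /=.
by apply: eq_bigr => k _; rewrite !mxE mulrC.
Qed.

(** * Vector-valued power series in one variable *)

(** The values of [g] outside the disc are unconstrained; [g] is nevertheless
    total so that the derivatives [derive1n n g], which only depend on germs,
    can be formed and shown to be power series on the same disc. *)
Definition power_series_on (R : realType) (V : normedModType R)
    (a : nat -> V) (r : R) (g : R -> V) : Prop :=
  forall t : R, `|t| < r -> series (fun k => t ^+ k *: a k) @ \oo --> g t.

(** The difference [K' ^+ k.+1 - K ^+ k.+1] is [K' - K] times a sum of [k.+1]
    products, each at least [K ^+ k]; so a slightly larger radius absorbs the
    factor [k.+1] produced by differentiation. *)
Lemma succ_expr_le (R : realType) (K K' : R) k : 0 < K -> K < K' ->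
  k.+1%:R * K ^+ k <= K' / (K' - K) * K' ^+ k.
Proof.
move=> K0 KK'; have d0 : 0 < K' - K by rewrite subr_gt0.
rewrite mulrAC -exprS ler_pdivlMr//.
apply: (@le_trans _ _ (K' ^+ k.+1 - K ^+ k.+1)); last first.
  by rewrite lerBlDr lerDl exprn_ge0// ltW.
rewrite subrXX mulrC ler_pM2l//=.
rewrite mulr_natl -[X in K ^+ k *+ X](card_ord k.+1) -sumr_const.
apply: ler_sum => i _; rewrite -{1}(subnK (leq_ord i)) exprD.
by rewrite ler_pM2r ?exprn_gt0// lerXn2r ?nnegrE ?ltW// (lt_trans K0).
Qed.

Lemma cvg_pseries_terms_bounded (R : realType) (c : R^nat) (K : R) :
  cvgn (pseries c K) -> exists2 B, 0 <= B & forall k, `|c k| * `|K| ^+ k <= B.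
Proof.
move=> /cvg_series_bounded [B [_ cB]].
exists (`|B| + 1) => [|k]; first by rewrite addr_ge0.
rewrite -normrX -normrM; apply: cB => //.
by rewrite (le_lt_trans (ler_norm _))// ltrDl.
Qed.

(** The terms [c k * K ^+ k] are bounded, so after [succ_expr_le] the
    differentiated series is dominated by a geometric one of ratio
    [K1 / `|K|]. *)
Lemma pseries_diffs_cvg (R : realType) (c : R^nat) (K t : R) :
  cvgn (pseries c K) -> `|t| < `|K| -> cvgn (pseries (pseries_diffs c) t).
Proof.
move=> /cvg_pseries_terms_bounded[B B0 cB] tK.
pose K1 := (`|t| + `|K|) / 2; pose K2 := (`|t| + K1) / 2.
have [tK1 K1K] : `|t| < K1 /\ K1 < `|K| by rewrite /K1 !midf_lt.
have [tK2 K2K1] : `|t| < K2 /\ K2 < K1 by rewrite /K2 !midf_lt.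
have K20 : 0 < K2 by exact: le_lt_trans tK2.
have K10 : 0 < K1 by exact: lt_trans K2K1.
have K0 : 0 < `|K| by exact: lt_trans K1K.
apply: normed_cvg; rewrite /normed_series_of /=.
have : cvgn (series (geometric (K1 / (K1 - K2) * (B / `|K|)) (K1 / `|K|))).
  apply: is_cvg_geometric_series.
  by rewrite gtr0_norm; [rewrite ltr_pdivrMr// mul1r|exact: divr_gt0].
apply: series_le_cvg => k //=.
  by rewrite !mulr_ge0 ?invr_ge0 ?exprn_ge0 ?divr_ge0 ?subr_ge0// ltW.
rewrite /pseries_diffs !normrM normrX ger0_norm//.
have ck : `|c k.+1| <= B / `|K| / `|K| ^+ k.
  by rewrite -mulrA -invfM -exprS ler_pdivlMr ?exprn_gt0.
have tk : `|t| ^+ k <= K2 ^+ k by rewrite lerXn2r ?nnegrE// ltW.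
have h := succ_expr_le k K20 K2K1.
apply: (@le_trans _ _ (`|c k.+1| * (k.+1%:R * K2 ^+ k))).
  rewrite [X in X * _]mulrC -mulrA ler_wpM2l// ler_wpM2l//.
apply: (le_trans (ler_pM _ _ ck h)) => //.
  by rewrite mulr_ge0// exprn_ge0// ltW.
rewrite le_eqVlt; apply/orP; left; apply/eqP.
by rewrite /= [(K1 / `|K|) ^+ k]expr_div_n; ring.
Qed.

(** [pseries_snd_diffs] differentiates termwise at [t] provided that the series
    and its first two formal derivatives converge at one point beyond [t].
    Each formal differentiation costs a little of the radius, whence the
    decreasing radii [K1], [K2] and [K3] between [`|t|] and [r]. *)
Lemma pseries_is_derive (R : realType) (c : R^nat) (r : R) (g : R -> R) :
  (forall t : R, `|t| < r -> pseries c t @ \oo --> g t) ->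
  forall t : R, `|t| < r -> is_derive t (1 : R) g (limn (pseries (pseries_diffs c) t)).
Proof.
move=> cg t tr.
pose K1 := (`|t| + r) / 2; pose K2 := (`|t| + K1) / 2.
have [tK1 K1r] : `|t| < K1 /\ K1 < r by rewrite /K1 !midf_lt.
have [tK2 K2K1] : `|t| < K2 /\ K2 < K1 by rewrite /K2 !midf_lt.
pose K3 := (`|t| + K2) / 2.
have [tK3 K3K2] : `|t| < K3 /\ K3 < K2 by rewrite /K3 !midf_lt.
have K30 : 0 < K3 by exact: le_lt_trans tK3.
have K20 : 0 < K2 by exact: lt_trans K3K2.
have K10 : 0 < K1 by exact: lt_trans K2K1.
have c1 : cvgn (pseries c K1).
  by apply/cvg_ex; exists (g K1); apply: cg; rewrite gtr0_norm.
have c2 : cvgn (pseries (pseries_diffs c) K2).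
  by apply: pseries_diffs_cvg c1 _; rewrite !gtr0_norm.
have c3 : cvgn (pseries (pseries_diffs (pseries_diffs c)) K3).
  by apply: pseries_diffs_cvg c2 _; rewrite !gtr0_norm.
have /near_eq_is_derive : \near t, limn (pseries c t) = g t.
  near=> s; apply/cvg_lim => //; apply: cg.
  near: s; exact: (cvgr_lt _ (@norm_continuous _ _ t) _ tr).
apply; apply: (@pseries_snd_diffs _ _ K3).
- by apply: is_cvg_pseries_inside c1 _; rewrite !gtr0_norm// (lt_trans K3K2).
- by apply: is_cvg_pseries_inside c2 _; rewrite !gtr0_norm// (lt_trans K3K2).
- exact: c3.
- by rewrite (gtr0_norm K30).
Unshelve. all: by end_near. Qed.

Lemma power_series_on_coord (R : realType) (n : nat) (a : nat -> 'rV[R]_n) (r : R)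
    (g : R -> 'rV[R]_n) i :
  power_series_on a r g ->
  forall t : R, `|t| < r -> pseries (fun k => a k ord0 i) t @ \oo --> g t ord0 i.
Proof.
by move=> ag t tr; rewrite -series_scale_coord; exact: cvg_coord (ag t tr).
Qed.

Lemma power_series_derivable (R : realType) (n : nat) (a : nat -> 'rV[R]_n) (r : R)
    (g : R -> 'rV[R]_n) :
  power_series_on a r g -> forall t : R, `|t| < r -> derivable g t 1.
Proof.
move=> ag t tr; apply/derivable_mxP => i j; rewrite ord1.
by have [] := pseries_is_derive (power_series_on_coord (i := j) ag) tr.
Qed.

Lemma power_series_derive1 (R : realType) (n : nat) (a : nat -> 'rV[R]_n) (r : R)
    (g : R -> 'rV[R]_n) :
  power_series_on a r g ->
  power_series_on (fun k => k.+1%:R *: a k.+1) r (derive1 g).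
Proof.
move=> ag t tr; apply: cvg_rV => i.
have dgi := pseries_is_derive (power_series_on_coord (i := i) ag) tr.
rewrite derive1E (derive_mx (power_series_derivable ag tr)) mxE.
rewrite (@derive_val _ _ _ _ _ _ _ dgi).
pose K := (`|t| + r) / 2.
have [tK Kr] : `|t| < K /\ K < r by rewrite /K !midf_lt.
have K0 : 0 < K by exact: le_lt_trans tK.
have : cvgn (pseries (pseries_diffs (fun k => a k ord0 i)) t).
  apply: (@pseries_diffs_cvg _ _ K); last by rewrite (gtr0_norm K0).
  apply/cvg_ex; exists (g K ord0 i); apply: (power_series_on_coord (i := i) ag).
  by rewrite gtr0_norm.
rewrite (series_scale_coord (fun k => k.+1%:R *: a k.+1)).
suff -> : (fun k => (k.+1%:R *: a k.+1) ord0 i) = pseries_diffs (fun k => a k ord0 i).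
  by [].
by apply/funext => k; rewrite mxE.
Qed.

Lemma power_series_derive1n (R : realType) (n : nat) (a : nat -> 'rV[R]_n) (r : R)
    (g : R -> 'rV[R]_n) m :
  power_series_on a r g ->
  power_series_on (fun k => ((k + m)`!%:R / k`!%:R) *: a (k + m)%N) r (derive1n m g).
Proof.
move=> ag; elim: m => [|m IH].
  rewrite (_ : (fun k => _) = a)//; apply/funext => k.
  by rewrite addn0 divff ?scale1r// pnatr_eq0 -lt0n fact_gt0.
move: (power_series_derive1 IH); rewrite -derive1nS.
set b := (X in power_series_on X _ _); set b' := (X in _ -> power_series_on X _ _).
suff -> : b = b' by []; apply/funext => k; rewrite /b /b'.
rewrite addnS -addSn scalerA; congr (_ *: _).
rewrite (factS k) natrM; field.
by rewrite ?nat1r ?natr1 !pnatr_eq0 -?lt0n ?fact_gt0.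
Qed.

Lemma power_series_on_coef0 (R : realType) (n : nat) (a : nat -> 'rV[R]_n) (r : R)
    (g : R -> 'rV[R]_n) :
  0 < r -> power_series_on a r g -> g 0 = a 0%N.
Proof.
move=> r0 /(_ 0); rewrite normr0 => /(_ r0) ag.
apply: (cvg_unique _ ag) => //.
apply: (@cvg_near_cst _ _ _ _ _ _ _).
near=> N; rewrite /series /=.
have N0 : (0 < N)%N by near: N; exact: nbhs_infty_gt.
rewrite -(prednK N0) big_nat_recl//= expr0 scale1r big1_seq ?addr0//.
by move=> k _; rewrite expr0n scale0r.
Unshelve. all: by end_near. Qed.

Lemma power_series_taylor (R : realType) (n : nat) (a : nat -> 'rV[R]_n) (r : R)
    (g : R -> 'rV[R]_n) m :
  0 < r -> power_series_on a r g -> derive1n m g 0 = m`!%:R *: a m.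
Proof.
move=> r0 ag; rewrite (power_series_on_coef0 r0 (power_series_derive1n (m := m) ag)).
by rewrite add0n fact0 divr1.
Qed.


(** * Absolute convergence and Lipschitz bound for multivariate series *)

(* The instance is local to the section that declares it. *)
#[local] Existing Instance summability.totally_filter.

Lemma partial_sumE (V : zmodType) (I : choiceType) (u : I -> V) (A : {fset I}) :
  summability.partial_sum u A = \sum_(i <- A) u i.
Proof. by rewrite /summability.partial_sum big_seq_fsetE. Qed.

Lemma ler_sum_fset (R : realType) (I : choiceType) (F : I -> R) (A B : {fset I}) :
  (A `<=` B)%fset -> (forall i, 0 <= F i) ->
  \sum_(i <- A) F i <= \sum_(i <- B) F i.
Proof.
move=> AB F0.
have -> : \sum_(i <- A) F i = \sum_(i <- B | i \in A) F i.
  rewrite [RHS]big_fset_condE; apply: eq_fbigl => i.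
  by rewrite !inE /= andbC; case: (boolP (i \in A)) => //= /(fsubsetP AB) ->.
rewrite [leRHS](bigID (mem A)) /= lerDl.
by apply: sumr_ge0.
Qed.

(** Beyond some finite set [A0] all partial sums are within [1] of the limit,
    so a finite family avoiding [A0] has sum at most [2] in absolute value.
    Applying this separately to the nonnegative and to the negative terms
    bounds the sum of absolute values off [A0] by [4]. *)
Lemma unconditional_sum_abs_bounded (R : realType) (I : choiceType) (u : I -> R)
    (l : R) :
  summability.partial_sum u @ summability.totally --> l ->
  exists M, forall A : {fset I}, \sum_(i <- A) `|u i| <= M.
Proof.
move=> /cvgrPdist_lt /(_ 1 ltr01) ul.
have [A0 _ A0l] : summability.totally
  (fun A => `|l - summability.partial_sum u A| < 1). by exact: ul.
exists (\sum_(i <- A0) `|u i| + 4) => A.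
have QA0 (F : I -> R) : \sum_(i <- (A0 `|` A)%fset | i \in A0) F i = \sum_(i <- A0) F i.
  rewrite [LHS]big_fset_condE; apply: eq_fbigl => i.
  by rewrite !inE /=; case: (i \in A0); rewrite //= andbF.
(* The sum over [B], minus the sum over [A0], leaves the terms off [A0]. *)
have key (P : pred I) :
    `|\sum_(i <- (A0 `|` A)%fset | (i \notin A0) && P i) u i| <= 2.
  pose B := [fset i in (A0 `|` A)%fset | (i \in A0) || P i]%fset.
  have A0B : (A0 `<=` B)%fset.
    by apply/fsubsetP => i iA; rewrite !inE /= iA.
  have h0 : `|l - \sum_(i <- A0) u i| < 1.
    by rewrite -partial_sumE; apply: A0l => /=.
  have hB : `|l - \sum_(i <- B) u i| < 1.
    by rewrite -partial_sumE; apply: A0l.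
  have -> : \sum_(i <- (A0 `|` A)%fset | (i \notin A0) && P i) u i =
      \sum_(i <- B) u i - \sum_(i <- A0) u i.
    rewrite -[\sum_(i <- B) _]big_fset_condE (bigID (mem A0)) /= -QA0.
    rewrite [X in _ = X + _ - _](eq_bigl (fun i => i \in A0)); last first.
      by move=> i /=; case: (i \in A0); rewrite ?andbF.
    rewrite addrC addKr; apply: eq_bigl => i /=.
    by case: (i \in A0); rewrite ?andbF ?andbT.
  have -> : \sum_(i <- B) u i - \sum_(i <- A0) u i =
    (l - \sum_(i <- A0) u i) - (l - \sum_(i <- B) u i) by ring.
  by rewrite (le_trans (ler_normB _ _))// -[2]/(1 + 1) lerD// ltW.
have AQ : (A `<=` A0 `|` A)%fset by rewrite fsubsetUr.
apply: (le_trans (ler_sum_fset AQ (fun i => normr_ge0 (u i)))).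
rewrite (bigID (mem A0)) /= QA0 lerD2l.
rewrite (bigID (fun i => 0 <= u i)) /= -[4]/(2 + 2)%:R natrD lerD//.
  apply: le_trans (key (fun i => 0 <= u i)); apply: le_trans (ler_norm _).
  by apply: ler_sum => i /andP[_ ui]; rewrite ger0_norm.
apply: le_trans (key (fun i => ~~ (0 <= u i))); rewrite -normrN.
apply: le_trans (ler_norm _); rewrite -sumrN.
by apply: ler_sum => i /andP[_]; rewrite -ltNge => ui; rewrite ltr0_norm.
Qed.

Definition mdegree (m : nat) (alpha : {ffun 'I_m -> nat}) : nat :=
  (\sum_(i < m) alpha i)%N.

(** Absolute convergence of the series on the closed polydisc of radius [rho],
    as a bound uniform in the finite set of multi-indices. *)
Definition majorized (R : realType) (V : normedModType R) (m : nat)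
    (c : {ffun 'I_m -> nat} -> V) (rho M : R) : Prop :=
  forall A : {fset {ffun 'I_m -> nat}},
    \sum_(alpha <- A) `|c alpha| * rho ^+ mdegree alpha <= M.

Lemma majorized_ge0 (R : realType) (V : normedModType R) (m : nat)
    (c : {ffun 'I_m -> nat} -> V) (rho M : R) : majorized c rho M -> 0 <= M.
Proof. by move=> /(_ fset0); rewrite big_seq_fset0. Qed.

(** At the corner [(rho, ..., rho)] of the cube the monomial of index [alpha]
    equals [rho ^+ mdegree alpha], so convergence at this single point bounds
    the series of absolute values, coordinate by coordinate. *)
Lemma analytic_majorized (R : realType) (m n : nat)
    (c : {ffun 'I_m -> nat} -> 'rV[R]_n) (rho : R) (l : 'rV[R]_n) :
  0 <= rho ->
  summability.partial_sum (fun alpha => monomial alpha (const_mx rho) *: c alpha)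
    @ summability.totally --> l ->
  exists M, majorized c rho M.
Proof.
move=> rho0 cl.
have monE (alpha : {ffun 'I_m -> nat}) :
    monomial alpha (const_mx rho) = rho ^+ mdegree alpha.
  rewrite /monomial /mdegree -prodrXr; apply: eq_bigr => i _.
  by rewrite mxE.
have /choice[M cM] (i : 'I_n) : exists Mi, forall A : {fset {ffun 'I_m -> nat}},
    \sum_(alpha <- A) `|c alpha ord0 i| * rho ^+ mdegree alpha <= Mi.
  have /unconditional_sum_abs_bounded[Mi cMi] : summability.partial_sum
      (fun alpha => monomial alpha (const_mx rho) * c alpha ord0 i)
      @ summability.totally --> l ord0 i.
    rewrite (_ : summability.partial_sum _ = fun A => summability.partial_sum
        (fun alpha => monomial alpha (const_mx rho) *: c alpha) A ord0 i).
      exact: cvg_coord cl.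
    apply/funext => A; rewrite !partial_sumE summxE.
    by apply: eq_bigr => alpha _; rewrite mxE.
  exists Mi => A.
  apply: le_trans (cMi A); apply: ler_sum => alpha _.
  by rewrite monE normrM (ger0_norm (exprn_ge0 _ rho0)) mulrC.
exists (\sum_i M i) => A.
apply: (@le_trans _ _ (\sum_(alpha <- A) \sum_(i < n)
    `|c alpha ord0 i| * rho ^+ mdegree alpha)).
  apply: ler_sum => alpha _; rewrite -mulr_suml ler_wpM2r ?exprn_ge0//.
  apply: ler_rV_norm => [|i]; first by apply: sumr_ge0.
  by rewrite (bigD1 i)//= lerDl sumr_ge0.
by rewrite exchange_big /=; apply: ler_sum => i _.
Qed.

Lemma normr_prod_le1 (R : realType) (I : Type) (s : seq I) (a : I -> R) :
  (forall i, `|a i| <= 1) -> `|\prod_(i <- s) a i| <= 1.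
Proof.
move=> a1; elim/big_rec: _ => [|i x _ x1]; first by rewrite normr1.
by rewrite normrM mulr_ile1.
Qed.

(** Telescoping: replacing the factors one at a time changes the product by at
    most the distance of the two factors, the others having norm at most 1. *)
Lemma prod_dist_le (R : realType) (I : Type) (s : seq I) (a b : I -> R) :
  (forall i, `|a i| <= 1) -> (forall i, `|b i| <= 1) ->
  `|\prod_(i <- s) a i - \prod_(i <- s) b i| <= \sum_(i <- s) `|a i - b i|.
Proof.
move=> a1 b1; elim: s => [|i s IH]; first by rewrite !big_nil subrr normr0.
rewrite !big_cons.
have -> : a i * \prod_(j <- s) a j - b i * \prod_(j <- s) b j =
  (a i - b i) * \prod_(j <- s) a j + b i * (\prod_(j <- s) a j - \prod_(j <- s) b j).
  by ring.
rewrite (le_trans (ler_normD _ _))// !normrM lerD//.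
  by rewrite ler_piMr// normr_prod_le1.
by apply: le_trans IH; rewrite ler_piMl.
Qed.

(** A power is a product of [k] equal factors, so [prod_dist_le] applies. *)
Lemma expr_dist_le (R : realType) (x y : R) k :
  `|x| <= 1 -> `|y| <= 1 -> `|x ^+ k - y ^+ k| <= k%:R * `|x - y|.
Proof.
move=> x1 y1.
have := @prod_dist_le R _ (index_iota 0 k) (fun=> x) (fun=> y) (fun=> x1) (fun=> y1).
by rewrite !prodr_const_nat sumr_const_nat subn0 mulr_natl.
Qed.

(** Rescaling by [q] reduces to the unit cube, where [prod_dist_le] applies.
    The factor [q] on the left avoids the exponent [mdegree alpha - 1]. *)
Lemma monomial_dist_le (R : realType) (m : nat) (alpha : {ffun 'I_m -> nat})
    (h h' : 'rV[R]_m) (q : R) : 0 < q -> `|h| <= q -> `|h'| <= q ->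
  `|monomial alpha h - monomial alpha h'| * q <=
  (mdegree alpha)%:R * q ^+ mdegree alpha * `|h - h'|.
Proof.
move=> q0 hq h'q.
have monZ (v : 'rV[R]_m) : monomial alpha v =
    q ^+ mdegree alpha * \prod_(i < m) (v ord0 i / q) ^+ alpha i.
  rewrite /monomial /mdegree -prodrXr -big_split /=; apply: eq_bigr => i _.
  by rewrite -exprMn mulrC divfK ?gt_eqF.
have le1 (v : 'rV[R]_m) i : `|v| <= q -> `|v ord0 i / q| <= 1.
  move=> vq; rewrite normrM normfV (gtr0_norm q0) ler_pdivrMr// mul1r.
  exact: le_trans (ler_norm_coord _ _) vq.
rewrite !monZ -mulrBr normrM (ger0_norm (exprn_ge0 _ (ltW q0))).
rewrite [leRHS]mulrAC [leRHS]mulrC -[leLHS]mulrA.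
rewrite (ler_wpM2l (exprn_ge0 _ (ltW q0)))//.
rewrite -ler_pdivlMr//.
have X1 (v : 'rV[R]_m) i : `|v| <= q -> `|(v ord0 i / q) ^+ alpha i| <= 1.
  by move=> vq; rewrite normrX exprn_ile1// le1.
apply: le_trans (prod_dist_le _ _ _) _ => [i|i|]; [exact: X1|exact: X1|].
rewrite /mdegree natr_sum -mulrA mulr_suml; apply: ler_sum => i _.
rewrite (le_trans (expr_dist_le _ (le1 _ _ hq) (le1 _ _ h'q)))//.
rewrite ler_wpM2l// -mulrBl normrM normfV (gtr0_norm q0).
rewrite ler_wpM2r// ?invr_ge0 ?(ltW q0)//.
by have := ler_norm_coord (h - h') i; rewrite !mxE.
Qed.

(** Halving the radius pays for the factor [mdegree alpha] of
    [monomial_dist_le], since [k <= 2 ^ k]: the Lipschitz constants of the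
    terms then have sum at most [M * 2 / rho]. *)
Lemma analytic_lipschitz (R : realType) (V : normedModType R) (m : nat)
    (c : {ffun 'I_m -> nat} -> V) (f : 'rV[R]_m -> V) (p : 'rV[R]_m) (r rho M : R) :
  0 < rho -> rho < r -> majorized c rho M ->
  (forall y, `|y - p| < r ->
    summability.partial_sum (fun alpha => monomial alpha (y - p) *: c alpha)
      @ summability.totally --> f y) ->
  forall y y', `|y - p| <= rho / 2 -> `|y' - p| <= rho / 2 ->
    `|f y - f y'| <= M * 2 / rho * `|y - y'|.
Proof.
move=> rho0 rhor cM cf y y' yp y'p.
have q0 : 0 < rho / 2 by rewrite divr_gt0.
have qr : rho / 2 < r.
  by apply: le_lt_trans rhor; rewrite ler_pdivrMr// ler_peMr ?ler1n// ltW.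
rewrite -[f y - f y']subr0.
apply: (cvg_dist_le (cvgB (cf y (le_lt_trans yp qr)) (cf y' (le_lt_trans y'p qr)))).
near=> A; rewrite subr0 !fctE !partial_sumE -sumrB.
apply: (le_trans (ler_norm_sum _ _ _)).
rewrite -(@ler_pM2r _ (rho / 2))// mulr_suml.
have -> : M * 2 / rho * `|y - y'| * (rho / 2) = M * `|y - y'|.
  by field; rewrite gt_eqF.
apply: le_trans (ler_wpM2r (normr_ge0 (y - y')) (cM A)).
rewrite mulr_suml; apply: ler_sum => alpha _.
rewrite -scalerBl normrZ mulrAC.
have := monomial_dist_le alpha q0 yp y'p.
rewrite opprB addrA subrK => /(ler_wpM2r (normr_ge0 (c alpha))) /le_trans; apply.
rewrite mulrC mulrA ler_wpM2r// ler_wpM2l//.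
rewrite expr_div_n mulrCA ler_piMr ?(exprn_ge0 _ (ltW rho0))//.
by rewrite ler_pdivrMr ?exprn_gt0// mul1r -natrX ler_nat ltnW// ltn_expl.
Unshelve. all: by end_near. Qed.

(** * Composition of a multivariate series with polynomial curves *)

(** The weighted l1 norm of the coefficients: it dominates the sup norm on the
    disc of radius [r] and is submultiplicative, with constant 1. *)
Definition pnorm (R : realType) (r : R) (p : {poly R}) : R :=
  \sum_(0 <= i < size p) `|p`_i| * r ^+ i.

Lemma pnorm_wide (R : realType) (r : R) (p : {poly R}) n : (size p <= n)%N ->
  pnorm r p = \sum_(0 <= i < n) `|p`_i| * r ^+ i.
Proof.
move=> pn; rewrite /pnorm (big_cat_nat (leq0n _) pn)//=.
rewrite [X in _ + X]big1_seq ?addr0// => i.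
by rewrite mem_index_iota => /andP[_ /andP[pi _]]; rewrite nth_default// normr0 mul0r.
Qed.

Lemma pnorm_ge0 (R : realType) (r : R) (p : {poly R}) : 0 <= r -> 0 <= pnorm r p.
Proof. by move=> r0; apply: sumr_ge0 => i _; rewrite mulr_ge0// exprn_ge0. Qed.

Definition abs_poly (R : realType) (p : {poly R}) : {poly R} :=
  \poly_(i < size p) `|p`_i|.

Lemma coef_abs_poly (R : realType) (p : {poly R}) i : (abs_poly p)`_i = `|p`_i|.
Proof.
by rewrite coef_poly; case: ltnP => // pi; rewrite nth_default ?normr0.
Qed.

Lemma horner_abs_poly (R : realType) (r : R) (p : {poly R}) :
  (abs_poly p).[r] = pnorm r p.
Proof. by rewrite horner_poly /pnorm big_mkord. Qed.

(** The product of [abs_poly p] and [abs_poly q] dominates [p * q]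
    coefficientwise, and its value at [r] is the product of the norms. *)
Lemma pnormM (R : realType) (r : R) (p q : {poly R}) : 0 <= r ->
  pnorm r (p * q) <= pnorm r p * pnorm r q.
Proof.
move=> r0; rewrite -!horner_abs_poly -hornerM.
pose n := maxn (size (abs_poly (p * q))) (size (abs_poly p * abs_poly q)).
rewrite (@horner_coef_wide _ n)//; last exact: leq_maxl.
rewrite (@horner_coef_wide _ n)//; last exact: leq_maxr.
apply: ler_sum => i _; rewrite ler_wpM2r ?exprn_ge0// coef_abs_poly !coefM.
apply: (le_trans (ler_norm_sum _ _ _)); apply: ler_sum => j _.
by rewrite normrM !coef_abs_poly.
Qed.

Lemma pnorm1 (R : realType) (r : R) : pnorm r 1 = 1.
Proof. by rewrite /pnorm size_poly1 big_nat1 coefC eqxx normr1 expr0 mulr1. Qed.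

(** For [i >= N], [`|s| ^+ i <= (`|s| / r) ^+ N * r ^+ i]. *)
Lemma horner_tail_le (R : realType) (r s : R) (p : {poly R}) N :
  0 < r -> `|s| <= r ->
  `|p.[s] - \sum_(0 <= i < N) p`_i * s ^+ i| <= (`|s| / r) ^+ N * pnorm r p.
Proof.
move=> r0 sr; pose n := maxn (size p) N.
have [pn Nn] : (size p <= n)%N /\ (N <= n)%N by rewrite leq_maxl leq_maxr.
rewrite (horner_coef_wide _ pn) -(big_mkord xpredT (fun i => p`_i * s ^+ i)).
rewrite (pnorm_wide _ pn) !(big_cat_nat (leq0n _) Nn)/=.
rewrite [X in `|X|]addrC addKr.
apply: (le_trans (ler_norm_sum _ _ _)).
rewrite mulrDr ler_wpDl//.
  rewrite mulr_ge0 ?exprn_ge0 ?divr_ge0 ?(ltW r0)//.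
  by apply: sumr_ge0 => i _; rewrite mulr_ge0 ?exprn_ge0// ltW.
rewrite mulr_sumr [leLHS]big_seq [leRHS]big_seq; apply: ler_sum => i.
rewrite mem_index_iota => /andP[Ni _].
rewrite normrM mulrCA ler_wpM2l// normrX -(subnKC Ni) !exprD expr_div_n.
rewrite mulrA divfK ?expf_neq0 ?gt_eqF// ler_wpM2l ?exprn_ge0//.
by rewrite lerXn2r ?nnegrE// ltW.
Qed.

Definition poly_monomial (R : realType) (m : nat) (alpha : {ffun 'I_m -> nat})
    (H : 'I_m -> {poly R}) : {poly R} := \prod_(i < m) H i ^+ alpha i.

Lemma pnormX_le (R : realType) (r rho : R) (p : {poly R}) k :
  0 <= r -> pnorm r p <= rho -> pnorm r (p ^+ k) <= rho ^+ k.
Proof.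
move=> r0 pr; elim: k => [|k IH]; first by rewrite !expr0 pnorm1.
rewrite !exprS (le_trans (pnormM _ _ r0))// ler_pM// pnorm_ge0//.
Qed.

Lemma pnorm_monomial_le (R : realType) (m : nat) (r rho : R)
    (alpha : {ffun 'I_m -> nat}) (H : 'I_m -> {poly R}) : 0 <= r ->
  (forall i, pnorm r (H i) <= rho) ->
  pnorm r (poly_monomial alpha H) <= rho ^+ mdegree alpha.
Proof.
move=> r0 Hr; rewrite /poly_monomial /mdegree -prodrXr.
elim/big_ind2 : _ => [|p x q y px qy|i _]; first by rewrite pnorm1.
  by rewrite (le_trans (pnormM _ _ r0))// ler_pM// pnorm_ge0.
exact: pnormX_le.
Qed.

Lemma horner_poly_monomial (R : realType) (m : nat) (alpha : {ffun 'I_m -> nat})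
    (H : 'I_m -> {poly R}) (s : R) :
  (poly_monomial alpha H).[s] = monomial alpha (\row_i (H i).[s]).
Proof.
rewrite /poly_monomial /monomial horner_prod; apply: eq_bigr => i _.
by rewrite horner_exp mxE.
Qed.

(** Each [H i] is divisible by ['X], so the monomial is divisible by
    ['X^(mdegree alpha)]. *)
Lemma coef_monomial_small (R : realType) (m : nat) (alpha : {ffun 'I_m -> nat})
    (H : 'I_m -> {poly R}) n : (forall i, (H i)`_0 = 0) ->
  (n < mdegree alpha)%N -> (poly_monomial alpha H)`_n = 0.
Proof.
move=> H0 n_lt.
have -> : poly_monomial alpha H =
    'X^(mdegree alpha) * \prod_(i < m) (drop_poly 1 (H i)) ^+ alpha i.
  rewrite /poly_monomial /mdegree -prodrXr -big_split /=; apply: eq_bigr => i _.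
  rewrite -exprMn; congr (_ ^+ _).
  rewrite -[LHS](poly_take_drop 1) expr1 mulrC (_ : take_poly 1 _ = 0) ?add0r//.
  by apply/polyP => -[|k]; rewrite coef_take_poly coef0 ?H0.
by rewrite coefXnM n_lt.
Qed.

(** The coefficients of degree at most [n] of a product only involve the
    coefficients of degree at most [n] of the factors. *)
Lemma coef_monomial_agree (R : realType) (m : nat) (alpha : {ffun 'I_m -> nat})
    (H H' : 'I_m -> {poly R}) n :
  (forall i k, (k <= n)%N -> (H i)`_k = (H' i)`_k) ->
  forall k, (k <= n)%N -> (poly_monomial alpha H)`_k = (poly_monomial alpha H')`_k.
Proof.
move=> HH'.
have agreeM (p p' q q' : {poly R}) :
    (forall k, (k <= n)%N -> p`_k = p'`_k) ->
    (forall k, (k <= n)%N -> q`_k = q'`_k) ->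
    forall k, (k <= n)%N -> (p * q)`_k = (p' * q')`_k.
  move=> pp' qq' k kn; rewrite !coefM; apply: eq_bigr => j _.
  by rewrite pp' ?qq'// ?(leq_trans (leq_subr _ _))// (leq_trans (leq_ord j)).
rewrite /poly_monomial; elim/big_ind2 : _ => // [p q p' q' pq pq'|i _].
  exact: agreeM.
elim: (alpha i) => [|a IH] k kn; first by rewrite !expr0.
by rewrite !exprS; apply: agreeM kn => // j; exact: HH'.
Qed.

Definition multi_box (m n : nat) : {fset {ffun 'I_m -> nat}} :=
  ((fun beta : {ffun 'I_m -> 'I_n.+1} => [ffun i => val (beta i)] : {ffun 'I_m -> nat})
    @` [fset beta in {: {ffun 'I_m -> 'I_n.+1}}])%fset.

Lemma in_multi_box (m n : nat) (alpha : {ffun 'I_m -> nat}) :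
  (forall i, (alpha i <= n)%N) -> alpha \in multi_box m n.
Proof.
move=> an; apply/imfsetP; exists [ffun i => inord (alpha i)]; first by rewrite !inE.
by apply/ffunP => i; rewrite !ffunE /= inordK// ltnS.
Qed.

Lemma multi_boxP (m n : nat) (alpha : {ffun 'I_m -> nat}) :
  alpha \in multi_box m n -> forall i, (alpha i <= n)%N.
Proof.
by move=> /imfsetP[beta _ ->] i; rewrite ffunE /= -ltnS.
Qed.

Lemma multi_box_sub (m n N : nat) :
  (n <= N)%N -> (multi_box m n `<=` multi_box m N)%fset.
Proof.
move=> nN; apply/fsubsetP => alpha /multi_boxP an.
by apply: in_multi_box => i; exact: leq_trans (an i) nN.
Qed.

(** The coefficient of [s^n] in [sum_alpha c_alpha H(s)^alpha].  When [H(0) = 0]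
    the multi-indices outside the box have degree greater than [n] and do not
    contribute; this is [comp_coef_wide]. *)
Definition comp_coef (R : realType) (V : normedModType R) (m : nat)
    (c : {ffun 'I_m -> nat} -> V) (H : 'I_m -> {poly R}) (n : nat) : V :=
  \sum_(alpha <- multi_box m n) (poly_monomial alpha H)`_n *: c alpha.

Lemma comp_coef_agree (R : realType) (V : normedModType R) (m : nat)
    (c : {ffun 'I_m -> nat} -> V) (H H' : 'I_m -> {poly R}) n :
  (forall i k, (k <= n)%N -> (H i)`_k = (H' i)`_k) ->
  comp_coef c H n = comp_coef c H' n.
Proof.
move=> HH'; apply: eq_bigr => alpha _.
by rewrite (coef_monomial_agree alpha HH').
Qed.

Lemma comp_coef_wide (R : realType) (V : normedModType R) (m : nat)
    (c : {ffun 'I_m -> nat} -> V) (H : 'I_m -> {poly R}) n (A : {fset _}) :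
  (forall i, (H i)`_0 = 0) -> (multi_box m n `<=` A)%fset ->
  comp_coef c H n = \sum_(alpha <- A) (poly_monomial alpha H)`_n *: c alpha.
Proof.
move=> H0 nA; apply: big_fset_incl nA _ => alpha _ alphan.
rewrite coef_monomial_small ?scale0r// ltnNge; apply: contra alphan => an.
apply: in_multi_box => i; apply: leq_trans an.
by rewrite /mdegree (bigD1 i)//= leq_addr.
Qed.

(** The monomial of index [alpha] in [H] has norm at most
    [rho ^+ mdegree alpha], so exchanging the two sums leaves the majorant of
    the outer series. *)
Lemma comp_coef_sum_le (R : realType) (V : normedModType R) (m : nat)
    (c : {ffun 'I_m -> nat} -> V) (rho M r : R) (H : 'I_m -> {poly R}) N :
  majorized c rho M -> 0 <= r -> (forall i, (H i)`_0 = 0) ->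
  (forall i, pnorm r (H i) <= rho) ->
  \sum_(0 <= n < N) `|comp_coef c H n| * r ^+ n <= M.
Proof.
move=> cM r0 H0 Hr; apply: le_trans (cM (multi_box m N)).
apply: (@le_trans _ _ (\sum_(0 <= n < N) \sum_(alpha <- multi_box m N)
    `|c alpha| * (`|(poly_monomial alpha H)`_n| * r ^+ n))).
  rewrite [leLHS]big_seq [leRHS]big_seq; apply: ler_sum => n.
  rewrite mem_index_iota => /andP[_ /ltnW nN].
  rewrite (comp_coef_wide _ H0 (multi_box_sub m nN)).
  apply: (le_trans (ler_wpM2r (exprn_ge0 _ r0) (ler_norm_sum _ _ _))).
  rewrite mulr_suml; apply: ler_sum => alpha _.
  by rewrite normrZ mulrCA mulrA.
rewrite exchange_big /=; apply: ler_sum => alpha _.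
rewrite -mulr_sumr ler_wpM2l//.
apply: le_trans (pnorm_monomial_le alpha r0 Hr).
set p := poly_monomial _ _.
rewrite (pnorm_wide r (leq_maxl (size p) N)).
rewrite [leRHS](big_cat_nat (leq0n _) (leq_maxr (size p) N))//= lerDl.
by apply: sumr_ge0 => i _; rewrite mulr_ge0// exprn_ge0.
Qed.

(** For a finite set of multi-indices containing the box of size [N], the
    difference is a combination of the remainders of order [N] of the
    polynomials [poly_monomial alpha H]; [horner_tail_le] bounds it by the
    majorant, independently of the finite set, and the bound passes to the
    limit. *)
Lemma comp_tail_le (R : realType) (V : normedModType R) (m : nat)
    (c : {ffun 'I_m -> nat} -> V) (f : 'rV[R]_m -> V) (p : 'rV[R]_m)
    (r0 rho M r s : R) (H : 'I_m -> {poly R}) N :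
  0 <= rho -> rho < r0 -> majorized c rho M ->
  (forall y, `|y - p| < r0 ->
    summability.partial_sum (fun alpha => monomial alpha (y - p) *: c alpha)
      @ summability.totally --> f y) ->
  (forall i, (H i)`_0 = 0) -> 0 < r -> (forall i, pnorm r (H i) <= rho) ->
  `|s| <= r ->
  `|f (p + \row_i (H i).[s]) - \sum_(0 <= n < N) s ^+ n *: comp_coef c H n|
    <= (`|s| / r) ^+ N * M.
Proof.
move=> rho0 rhor0 cM cf H0 r_gt0 Hr sr.
have Hs : `|\row_i (H i).[s]| <= rho.
  apply: ler_rV_norm rho0 _ => i; rewrite mxE.
  have := horner_tail_le (H i) 0 r_gt0 sr.
  by rewrite big_geq// subr0 expr0 mul1r => /le_trans; apply.
have := cf (p + \row_i (H i).[s]).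
rewrite addrC addKr => /(_ (le_lt_trans Hs rhor0)) cfs.
apply: (cvg_dist_le cfs); exists (multi_box m N) => // A /= NA.
have -> : \sum_(0 <= n < N) s ^+ n *: comp_coef c H n =
    \sum_(alpha <- A) (\sum_(0 <= n < N) (poly_monomial alpha H)`_n * s ^+ n) *: c alpha.
  under [RHS]eq_bigr do rewrite scaler_suml.
  rewrite exchange_big /= [LHS]big_seq [RHS]big_seq; apply: eq_bigr => n.
  rewrite mem_index_iota => /andP[_ /ltnW nN].
  rewrite (comp_coef_wide _ H0 (fsubset_trans (multi_box_sub m nN) NA)).
  by rewrite scaler_sumr; apply: eq_bigr => alpha _; rewrite scalerA mulrC.
rewrite partial_sumE -sumrB; apply: (le_trans (ler_norm_sum _ _ _)).
apply: le_trans (ler_wpM2l _ (cM A)); last by rewrite exprn_ge0// divr_ge0// ltW.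
rewrite mulr_sumr; apply: ler_sum => alpha _.
rewrite -scalerBl normrZ -horner_poly_monomial mulrCA mulrC ler_wpM2l//.
apply: le_trans (horner_tail_le _ _ r_gt0 sr) _.
rewrite ler_wpM2l ?exprn_ge0 ?divr_ge0 ?(ltW r_gt0)//.
exact: pnorm_monomial_le (ltW r_gt0) Hr.
Qed.

Lemma comp_power_series (R : realType) (V : normedModType R) (m : nat)
    (c : {ffun 'I_m -> nat} -> V) (f : 'rV[R]_m -> V) (p : 'rV[R]_m)
    (r0 rho M r : R) (H : 'I_m -> {poly R}) :
  0 <= rho -> rho < r0 -> majorized c rho M ->
  (forall y, `|y - p| < r0 ->
    summability.partial_sum (fun alpha => monomial alpha (y - p) *: c alpha)
      @ summability.totally --> f y) ->
  (forall i, (H i)`_0 = 0) -> 0 < r -> (forall i, pnorm r (H i) <= rho) ->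
  power_series_on (comp_coef c H) r (fun s => f (p + \row_i (H i).[s])).
Proof.
move=> rho0 rhor0 cM cf H0 r_gt0 Hr s sr.
apply/cvgrPdist_le => e e0.
have geo : (fun N => (`|s| / r) ^+ N * M) @ \oo --> 0 * M.
  apply: cvgM; last exact: cvg_cst.
  by apply: cvg_expr; rewrite ger0_norm ?divr_ge0 ?(ltW r_gt0)// ltr_pdivrMr ?mul1r.
rewrite mul0r in geo.
near=> N; rewrite /series /=.
apply: (le_trans (comp_tail_le N rho0 rhor0 cM cf H0 r_gt0 Hr (ltW sr))).
by near: N; exact: (cvgr_le _ geo).
Unshelve. all: by end_near. Qed.

(** A polynomial without constant term satisfies [pnorm r p <= r * pnorm 1 p]
    for [r <= 1]. *)
Lemma pnorm_small (R : realType) (m : nat) (rho : R) (H : 'I_m -> {poly R}) :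
  0 < rho -> (forall i, (H i)`_0 = 0) ->
  exists2 r, 0 < r & forall i, pnorm r (H i) <= rho.
Proof.
move=> rho0 H0; pose S := 1 + \sum_i pnorm 1 (H i).
have S1 : 1 <= S by rewrite lerDl sumr_ge0// => i _; exact: pnorm_ge0.
have S0 : 0 < S by exact: lt_le_trans S1.
pose r := Num.min 1 (rho / S).
have r0 : 0 < r by rewrite lt_min ltr01 divr_gt0.
have r1 : r <= 1 by rewrite ge_min lexx.
exists r => // i.
apply: (@le_trans _ _ (r * pnorm 1 (H i))).
  rewrite /pnorm mulr_sumr; apply: ler_sum => -[|k] _.
    by rewrite H0 normr0 !mul0r mulr0.
  rewrite expr1n mulr1 mulrC ler_wpM2r// exprS ler_piMr ?exprn_ile1// ltW//.
apply: (@le_trans _ _ (rho / S * S)); last by rewrite divfK// gt_eqF.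
apply: ler_pM => //; [exact: ltW|exact: pnorm_ge0|by rewrite ge_min lexx orbT|].
rewrite /S (bigD1 i)//= addrCA lerDl addr_ge0// sumr_ge0// => j _.
exact: pnorm_ge0.
Qed.

(** * Uniqueness for the initial value problem *)

Lemma is_derive_coord (R : realType) (n : nat) (g : R -> 'rV[R]_n) (t : R)
    (dg : 'rV[R]_n) i :
  is_derive t 1 g dg -> is_derive t (1 : R) (fun s => g s ord0 i) (dg ord0 i).
Proof.
move=> gt; have dgt : derivable g t 1 by [].
have := derive_mx dgt; rewrite (@derive_val _ _ _ _ _ _ _ gt) => ->.
by rewrite mxE; apply: derivableP; exact: (derivable_mxP _ _ _).1 dgt ord0 i.
Qed.

Lemma derivable_cvg (R : realType) (n : nat) (g : R -> 'rV[R]_n) (t : R) :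
  derivable g t 1 -> g s @[s --> t] --> g t.
Proof. by move=> /derivable1_diffP /differentiable_continuous. Qed.

(** For the sup norm, the mean value theorem applied to each coordinate
    suffices. *)
Lemma mean_value_norm (R : realType) (n : nat) (g g' : R -> 'rV[R]_n) (t0 e K : R) :
  (forall s : R, `|s - t0| < e -> is_derive s 1 g (g' s)) ->
  (forall s : R, `|s - t0| < e -> `|g' s| <= K) ->
  forall t : R, `|t - t0| < e -> `|g t - g t0| <= K * `|t - t0|.
Proof.
move=> dg g'K t te.
have e0 : 0 < e by exact: le_lt_trans te.
have K0 : 0 <= K by apply: le_trans (g'K t te).
apply: ler_rV_norm => [|i]; first by rewrite mulr_ge0.
rewrite !mxE.
have seg a b : a <= b -> `|a - t0| < e -> `|b - t0| < e ->
    `|g b ord0 i - g a ord0 i| <= K * `|b - a|.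
  move=> ab; rewrite !ltr_norml => /andP[a1 a2] /andP[b1 b2].
  have cab s : s \in `[a, b] -> `|s - t0| < e.
    by rewrite in_itv /= ltr_norml => /andP[sa sb]; apply/andP; split; lra.
  have [s /cab se ->] := @MVT_segment R
    (fun s => g s ord0 i) (fun s => g' s ord0 i) a b ab
    (fun s sab => is_derive_coord i (dg s (cab s (subset_itv_oo_cc sab))))
    (derivable_within_continuous (fun s sab =>
      @ex_derive _ _ _ _ _ _ _ (is_derive_coord i (dg s (cab s sab))))).
  rewrite normrM ler_wpM2r// (le_trans (ler_norm_coord _ _))//.
  exact: g'K.
case: (leP t0 t) => [tt|/ltW tt].
  by apply: seg => //; rewrite subrr normr0.
by rewrite distrC [X in K * X]distrC; apply: seg => //; rewrite subrr normr0.
Qed.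

(** Near [t0] both solutions stay in the ball where [f] is Lipschitz.  On a
    neighbourhood of radius at most [1 / (2 (L + 1))], the mean value inequality
    halves any bound on [`|y t - x t|]; iterating from the bound [2 * q] makes
    the difference vanish. *)
Lemma ivp_unique_near (R : realType) (d : nat) (f : 'rV[R]_d -> 'rV[R]_d)
    (w : R -> 'rV[R]_d) (z : 'rV[R]_d) (r q L : R) (x y : R -> 'rV[R]_d) (t0 : R) :
  0 < q -> 0 <= L ->
  (forall u v, `|u - z| <= q -> `|v - z| <= q -> `|f u - f v| <= L * `|u - v|) ->
  ivp_solution f w z r x -> ivp_solution f w z r y ->
  t0 \in `]- r, r[ -> `|x t0 - z| < q -> y t0 = x t0 ->
  \forall t \near t0, y t = x t.
Proof.
move=> q0 L0 fL [_ dx] [_ dy] t0r xq yx0.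
have near_q (g : R -> 'rV[R]_d) : derivable g t0 1 -> `|g t0 - z| < q ->
    \forall t \near t0, `|g t - z| < q.
  move=> /derivable_cvg gt0 gq.
  have gz : (fun t => g t - z) @ t0 --> g t0 - z by apply: cvgB gt0 (cvg_cst _).
  exact: (cvgr_norm_lt _ gz _ gq).
have : \forall t \near t0, [/\ t \in `]- r, r[, `|x t - z| < q & `|y t - z| < q].
  near=> t; split; near: t.
  - exact: (open_nbhs_nbhs (conj (itv_open (- r) r) t0r)).
  - by apply: near_q => //; have := dx _ t0r.
  - by apply: near_q; [have := dy _ t0r|rewrite yx0].
move=> /nbhs_ballP[e0 /= e0_gt0 e0P].
pose e := Num.min e0 (2 * (L + 1))^-1.
have L1 : 0 < 2 * (L + 1) by rewrite mulr_gt0// ltr_wpDl.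
have e_gt0 : 0 < e by rewrite lt_min e0_gt0 invr_gt0.
have eP t : `|t - t0| < e -> [/\ t \in `]- r, r[, `|x t - z| < q & `|y t - z| < q].
  move=> te; apply: e0P; rewrite /ball /= distrC; apply: lt_le_trans te _.
  by rewrite ge_min lexx.
have bound k t : `|t - t0| < e -> `|y t - x t| <= geometric (2 * q) 2^-1 k.
  elim: k t => [|k IH] t te.
    have [_ xt yt] := eP t te.
    rewrite /= expr0 mulr1 mulr_natl mulr2n.
    have -> : y t - x t = (y t - z) - (x t - z) by rewrite opprB addrA subrK.
    by rewrite (le_trans (ler_normB _ _))// lerD// ltW.
  have := @mean_value_norm R d (y - x)
    (fun s => (f (y s) + w s) - (f (x s) + w s)) t0 e (L * geometric (2 * q) 2^-1 k)
    _ _ t te.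
  rewrite !fctE yx0 subrr subr0 => /(_ _ _)/le_trans; apply.
  - move=> s /eP[sr _ _].
    by apply: is_deriveB; [exact: dy|exact: dx].
  - move=> s se; have [_ xs ys] := eP s se.
    rewrite opprD addrACA subrr addr0.
    apply: le_trans (fL _ _ (ltW ys) (ltW xs)) _.
    by rewrite ler_wpM2l// IH.
  - have -> : geometric (2 * q) 2^-1 k.+1 = 2^-1 * geometric (2 * q) 2^-1 k.
      by rewrite /= exprS mulrCA.
    rewrite mulrAC ler_wpM2r//.
      by rewrite /= mulr_ge0// ?exprn_ge0// mulr_ge0// ltW.
    have te' : `|t - t0| * (2 * (L + 1)) < 1.
      by rewrite -ltr_pdivlMr// div1r (lt_le_trans te)// ge_min lexx orbT.
    have := normr_ge0 (t - t0); lra.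
exists e => //= t; rewrite /ball_ /= distrC => te.
apply/eqP; rewrite -subr_eq0 -normr_le0.
(* The bounds [2 * q / 2 ^ k] tend to 0. *)
have geo : geometric (2 * q) 2^-1 @ \oo --> (0 : R).
  by apply: cvg_geometric; rewrite ger0_norm ?invr_ge0// invf_lt1// ltr1n.
case: leP => // yx_gt0.
have [N _ /(_ N (leqnn N)) /=] := cvgr_lt _ geo _ yx_gt0.
by rewrite ltNge bound.
Unshelve. all: by end_near. Qed.

(** The set where the two solutions agree contains [0], is open by
    [ivp_unique_near] and closed by continuity, hence is the whole interval.
    Only [x] is known to stay near [z] in advance. *)
Lemma ivp_unique (R : realType) (d : nat) (f : 'rV[R]_d -> 'rV[R]_d)
    (w : R -> 'rV[R]_d) (z : 'rV[R]_d) (r q L : R) (x y : R -> 'rV[R]_d) :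
  0 < r -> 0 < q -> 0 <= L ->
  (forall u v, `|u - z| <= q -> `|v - z| <= q -> `|f u - f v| <= L * `|u - v|) ->
  ivp_solution f w z r x -> (forall t, t \in `]- r, r[ -> `|x t - z| < q) ->
  ivp_solution f w z r y ->
  forall t, t \in `]- r, r[ -> y t = x t.
Proof.
move=> r0 q0 L0 fL xsol xq ysol.
pose I := [set` `]- r, r[].
have Iopen : open I by exact: itv_open.
pose B := [set t | I t /\ y t = x t].
suff BI : B = I by move=> t tI; have : B t by [rewrite BI]; case.
have /connected_intervalP : is_interval I by exact: interval_is_interval.
apply.
- by exists 0; split; [rewrite /I /= in_itv /= oppr_lt0 r0|rewrite ysol.1 xsol.1].
- exists B; last by apply/seteqP; split=> [t [It ?]|t []//].
  rewrite openE => t [It yx]; rewrite /interior.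
  near=> s; split; near: s; first exact: open_nbhs_nbhs.
  exact: (ivp_unique_near q0 L0 fL xsol ysol It (xq _ It) yx).
- exists (~` [set t | I t /\ y t <> x t]); last first.
    apply/seteqP; split=> [t [It yx]|t [It /= /not_andP[]//]]; first by split=> // -[].
    by move=> /contrapT yx; split.
  apply: open_closedC; rewrite openE => t [It /eqP yx]; rewrite /interior.
  near=> s; split; near: s; first exact: open_nbhs_nbhs.
  have cyx : (y - x) s @[s --> t] --> y t - x t.
    by apply: cvgB; apply: derivable_cvg; [have := ysol.2 _ It|have := xsol.2 _ It].
  have : 0 < `|y t - x t| by rewrite normr_gt0 subr_eq0.
  move=> /(cvgr_norm_gt _ cyx); apply: filterS => s.
  by rewrite normr_gt0 subr_eq0 => /eqP.
Unshelve. all: by end_near. Qed.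

(** * The generalised flow as a composition coefficient *)

(** The constant term is dropped: the polynomial is the displacement from
    [a 0] along the truncated curve. *)
Definition curve_poly (R : realType) (d : nat) (a : nat -> 'rV[R]_d) (N : nat)
    (i : 'I_d) : {poly R} :=
  \poly_(k < N.+1) (if k == 0%N then 0 else a k ord0 i).

Lemma coef0_curve_poly (R : realType) (d : nat) (a : nat -> 'rV[R]_d) N i :
  (curve_poly a N i)`_0 = 0.
Proof. by rewrite coef_poly. Qed.

Lemma curve_poly_agree (R : realType) (d : nat) (a : nat -> 'rV[R]_d) n N :
  (n <= N)%N -> forall (i : 'I_d) k, (k <= n)%N ->
  (curve_poly a N i)`_k = (curve_poly a n i)`_k.
Proof.
by move=> nN i k kn; rewrite !coef_poly !ltnS kn (leq_trans kn nN).
Qed.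

Lemma horner_curve_poly (R : realType) (d : nat) (a : nat -> 'rV[R]_d) N s :
  a 0%N + \row_i (curve_poly a N i).[s] = series (fun k => s ^+ k *: a k) N.+1.
Proof.
apply/rowP => i; rewrite series_coord !mxE horner_poly /series /= big_mkord.
rewrite !big_ord_recl /= mul0r add0r expr0 scale1r; congr (_ + _).
by apply: eq_bigr => k _; rewrite mxE mulrC.
Qed.

Lemma pnorm_curve_poly (R : realType) (d : nat) (a : nat -> 'rV[R]_d) N i r :
  0 <= r ->
  pnorm r (curve_poly a N i) <= \sum_(0 <= k < N) `|a k.+1| * r ^+ k.+1.
Proof.
move=> r0; rewrite (@pnorm_wide _ _ _ N.+1) ?size_poly//.
rewrite big_nat_recl// coef0_curve_poly normr0 mul0r add0r.
rewrite [leLHS]big_seq [leRHS]big_seq; apply: ler_sum => k.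
rewrite mem_index_iota => /andP[_ kN].
by rewrite coef_poly ltnS kN /= ler_wpM2r ?exprn_ge0// ler_norm_coord.
Qed.

(** The curve inside [gen_flow] is [a 0] plus the displacement [curve_poly a n],
    along which [f] is a power series near [0]; the [n]-th derivative at [0]
    reads off its coefficient. *)
Lemma gen_flow_comp_coef (R : realType) (d : nat) (f : 'rV[R]_d -> 'rV[R]_d)
    (c : {ffun 'I_d -> nat} -> 'rV[R]_d) (r0 rho M : R) (a : nat -> 'rV[R]_d) n :
  0 < rho -> rho < r0 -> majorized c rho M ->
  (forall y, `|y - a 0%N| < r0 ->
    summability.partial_sum (fun alpha => monomial alpha (y - a 0%N) *: c alpha)
      @ summability.totally --> f y) ->
  gen_flow f (fun k : 'I_n.+1 => k`!%:R *: a k) =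
    n`!%:R *: comp_coef c (curve_poly a n) n.
Proof.
move=> rho0 rhor0 cM cf.
have [r r_gt0 Hr] := pnorm_small rho0 (coef0_curve_poly a n).
rewrite -(power_series_taylor n r_gt0
  (comp_power_series (ltW rho0) rhor0 cM cf (coef0_curve_poly a n) r_gt0 Hr)).
rewrite /gen_flow; congr (derive1n n _ 0); apply/funext => s.
rewrite horner_curve_poly /series /= big_mkord; congr (f _).
apply: eq_bigr => k _; rewrite scalerA divfK// pnatr_eq0 -lt0n fact_gt0//.
Qed.

(** The terms are bounded at radius [r / 2], so at radius [r / 4] they are
    dominated by a geometric series of ratio [1 / 2]. *)
Lemma power_series_abs_bounded (R : realType) (V : normedModType R)
    (a : nat -> V) (r : R) (g : R -> V) : 0 < r -> power_series_on a r g ->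
  exists K W, [/\ 0 < K, 0 <= W & forall s, 0 <= s -> s <= K -> forall N,
    \sum_(0 <= n < N) `|a n| * s ^+ n <= W].
Proof.
move=> r0 ag; pose K := r / 2.
have K0 : 0 < K by rewrite divr_gt0.
have : cvgn (fun n => K ^+ n *: a n).
  apply/cvg_ex; exists 0; apply: cvg_series_cvg_0; apply/cvg_ex; exists (g K).
  by apply: ag; rewrite gtr0_norm// ltr_pdivrMr// ltr_pMr// ltr1n.
move=> /cvg_seq_bounded [B [_ aB]].
pose W := `|B| + 1.
have W0 : 0 <= W by rewrite addr_ge0.
have aW n : `|a n| * K ^+ n <= W.
  have -> : `|a n| * K ^+ n = `|K ^+ n *: a n|.
    by rewrite normrZ mulrC normrX (gtr0_norm K0).
  by apply: aB => //; rewrite (le_lt_trans (ler_norm _))// ltrDl.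
exists (K / 2), (2 * W); split; [by rewrite divr_gt0|by rewrite mulr_ge0|].
move=> s s0 sK N.
apply: (@le_trans _ _ (2 * W - 2 * W * 2^-1 ^+ N)); last first.
  by rewrite lerBlDr lerDl mulr_ge0 ?exprn_ge0// mulr_ge0.
elim: N => [|N IH]; first by rewrite big_geq// expr0 mulr1 subrr.
rewrite big_nat_recr//=.
have : `|a N| * s ^+ N <= W * 2^-1 ^+ N.
  apply: (@le_trans _ _ (`|a N| * K ^+ N * 2^-1 ^+ N)).
    rewrite -mulrA -exprMn ler_wpM2l// lerXn2r ?nnegrE//.
    by rewrite mulr_ge0// ltW.
  by rewrite ler_wpM2r ?exprn_ge0.
by move: IH; rewrite exprS; lra.
Qed.

Lemma abs_bounded_power_series (R : realType) (n : nat) (a : nat -> 'rV[R]_n)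
    (r M : R) :
  0 <= r -> (forall N, \sum_(0 <= k < N) `|a k| * r ^+ k <= M) ->
  exists g, power_series_on a r g.
Proof.
move=> r0 aM.
exists (fun t => \row_i limn (pseries (fun k => a k ord0 i) t)) => t tr.
apply: cvg_rV => i; rewrite series_scale_coord mxE.
suff : cvgn (pseries (fun k => a k ord0 i) t) by [].
apply: normed_cvg; apply: nondecreasing_is_cvgn.
  move=> m N; exact: (@nondecreasing_series R
    (fun k => `|a k ord0 i * t ^+ k|) xpredT 0%N (fun k _ _ => normr_ge0 _)).
exists M => _ [N _ <-]; apply: le_trans (aM N).
apply: ler_sum => k _; rewrite [leLHS]normrM ler_pM//; first exact: ler_norm_coord.
by rewrite normrX lerXn2r ?nnegrE// ltW.
Qed.

(** * Convergence of the formal solution *)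

(** Comparison of coefficients in [x' = f(x) + w], when [b] is the coefficient
    sequence of [w].  The coefficient of degree [n] of [f(x)] only depends on
    the truncation of [x] at degree [n]. *)
Definition formal_solution (R : realType) (d : nat)
    (c : {ffun 'I_d -> nat} -> 'rV[R]_d) (b a : nat -> 'rV[R]_d) : Prop :=
  forall n, n.+1%:R *: a n.+1 = comp_coef c (curve_poly a n) n + b n.

(** Induction on [N].  As long as the partial sum is at most [sigma <= rho], the
    truncated curve is admissible in [comp_coef_sum_le]; then the recursion,
    multiplied by [r ^+ k.+1] and summed, bounds the next partial sum by
    [r * (M + W)]. *)
Lemma formal_solution_bound (R : realType) (d : nat)
    (c : {ffun 'I_d -> nat} -> 'rV[R]_d) (b a : nat -> 'rV[R]_d) (rho M W r sigma : R) :
  majorized c rho M -> formal_solution c b a -> 0 <= r -> sigma <= rho ->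
  (forall N, \sum_(0 <= n < N) `|b n| * r ^+ n <= W) ->
  0 <= sigma -> r * (M + W) <= sigma ->
  forall N, \sum_(0 <= k < N) `|a k.+1| * r ^+ k.+1 <= sigma.
Proof.
move=> cM ac r0 sr bW s0 rMW; elim=> [|N IH]; first by rewrite big_geq.
apply: le_trans rMW.
have HN i : pnorm r (curve_poly a N i) <= rho.
  exact: le_trans (pnorm_curve_poly a N i r0) (le_trans IH sr).
apply: (le_trans _ (ler_wpM2l r0 (lerD
  (comp_coef_sum_le N.+1 cM r0 (coef0_curve_poly a N) HN) (bW N.+1)))).
rewrite -big_split /= mulr_sumr [leLHS]big_seq [leRHS]big_seq; apply: ler_sum => k.
rewrite mem_index_iota ltnS => /andP[_ kN].
rewrite -mulrDl mulrCA -exprS ler_wpM2r ?exprn_ge0//.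
rewrite (comp_coef_agree c (curve_poly_agree a kN)).
apply: le_trans (ler_normD _ _); rewrite -(ac k) normrZ ger0_norm//.
by rewrite ler_peMl// ler1n.
Qed.

(** The [N]-th partial sum of the derived series is the sum of the Taylor
    polynomial of [f] along the truncated curve, which by [comp_tail_le] and
    the Lipschitz bound tends to [f (x t)], and of the [N]-th partial sum of the
    series of [w]. *)
Lemma formal_solution_ode (R : realType) (d : nat) (f : 'rV[R]_d -> 'rV[R]_d)
    (w x : R -> 'rV[R]_d) (c : {ffun 'I_d -> nat} -> 'rV[R]_d)
    (b a : nat -> 'rV[R]_d) (r0 rho M r L : R) :
  0 < rho -> rho < r0 -> majorized c rho M -> formal_solution c b a ->
  (forall y, `|y - a 0%N| < r0 ->
    summability.partial_sum (fun alpha => monomial alpha (y - a 0%N) *: c alpha)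
      @ summability.totally --> f y) ->
  0 < r -> (forall N, \sum_(0 <= k < N) `|a k.+1| * r ^+ k.+1 <= rho / 4) ->
  power_series_on b r w -> power_series_on a r x ->
  (forall u v, `|u - a 0%N| <= rho / 2 -> `|v - a 0%N| <= rho / 2 ->
    `|f u - f v| <= L * `|u - v|) ->
  forall t : R, `|t| < r ->
    `|x t - a 0%N| <= rho / 4 /\ is_derive t 1 x (f (x t) + w t).
Proof.
move=> rho0 rhor0 cM ac cf r_gt0 aB bw ax fL t tr.
have r_ge0 := ltW r_gt0.
have rho42 : rho / 4 <= rho / 2 by lra.
have sub N : `|series (fun k => t ^+ k *: a k) N.+1 - a 0%N| <= rho / 4.
  rewrite /series /= big_nat_recl// expr0 scale1r addrC addKr.
  apply: (le_trans (ler_norm_sum _ _ _)); apply: le_trans (aB N).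
  apply: ler_sum => k _; rewrite normrZ mulrC ler_wpM2l// normrX.
  by rewrite lerXn2r ?nnegrE// ltW.
have axS : (fun N => series (fun k => t ^+ k *: a k) N.+1) @ \oo --> x t.
  by rewrite (cvg_shiftS (series (fun k => t ^+ k *: a k))); exact: ax.
have xt : `|x t - a 0%N| <= rho / 4.
  by apply: (cvg_dist_le axS); near=> N; exact: sub.
split=> //.
have dx := power_series_derivable ax tr.
suff dxE : derive1 x t = f (x t) + w t.
  by rewrite -dxE derive1E; exact: derivableP.
apply: (cvg_unique _ (power_series_derive1 ax tr)) => //.
have HN N i : pnorm r (curve_poly a N i) <= rho.
  apply: le_trans (pnorm_curve_poly a N i r_ge0) (le_trans (aB N) _); lra.
pose S N := \sum_(0 <= n < N) t ^+ n *: comp_coef c (curve_poly a N) n.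
have -> : series (fun k => t ^+ k *: (k.+1%:R *: a k.+1)) =
    S \+ series (fun k => t ^+ k *: b k).
  apply/funext => N; rewrite /S /series /= -big_split /=.
  rewrite [LHS]big_seq [RHS]big_seq; apply: eq_bigr => k.
  rewrite mem_index_iota => /andP[_ /ltnW kN].
  by rewrite ac -scalerDr (comp_coef_agree c (curve_poly_agree a kN)).
apply: cvgD; last exact: bw.
have geo : (fun N => (`|t| / r) ^+ N * M +
    L * `|series (fun k => t ^+ k *: a k) N.+1 - x t|)
    @ \oo --> 0 * M + L * `|x t - x t|.
  apply: cvgD; apply: cvgM; [|exact: cvg_cst|exact: cvg_cst|].
    by apply: cvg_expr; rewrite ger0_norm ?divr_ge0// ltr_pdivrMr ?mul1r.
  by apply: cvg_norm; apply: cvgB => //; exact: cvg_cst.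
rewrite mul0r subrr normr0 mulr0 addr0 in geo.
apply/cvgrPdist_le => e e0.
near=> N; apply: (@le_trans _ _ ((`|t| / r) ^+ N * M +
    L * `|series (fun k => t ^+ k *: a k) N.+1 - x t|)); last first.
  by near: N; exact: (cvgr_le _ geo).
have tail := comp_tail_le N (ltW rho0) rhor0 cM cf
  (coef0_curve_poly a N) r_gt0 (HN N) (ltW tr).
rewrite horner_curve_poly in tail.
rewrite distrC.
have -> : S N - f (x t) = - (f (series (fun k => t ^+ k *: a k) N.+1) - S N) +
    (f (series (fun k => t ^+ k *: a k) N.+1) - f (x t)).
  by rewrite opprB addrA subrK.
rewrite (le_trans (ler_normD _ _))// lerD// ?normrN//.
by apply: fL; exact: le_trans rho42.
Unshelve. all: by end_near. Qed.

Theorem mainTheorem2 (R : realType) (d : nat) (z : 'rV[R]_d)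
    (f : 'rV[R]_d -> 'rV[R]_d) (T : set R) (w : R -> 'rV[R]_d)
    (xi : nat -> 'rV[R]_d)
    (T_open : open T) (T_itv : is_interval T) (T0 : T 0)
    (f_analytic : \forall y \near z, analytic_at f y)
    (w_analytic : \forall t \near (0 : R), analytic_curve_at w t)
    (xi_0 : xi 0%N = z)
    (xi_rec : forall n : nat,
       xi n.+1 = gen_flow f (fun k : 'I_n.+1 => xi k) + derive1n n w 0) :
  exists r : R, [/\ 0 < r, [set` `]- r, r[] `<=` T &
    exists x : R -> 'rV[R]_d,
      [/\ ivp_solution f w z r x,
          (forall y : R -> 'rV[R]_d, ivp_solution f w z r y ->
             forall t : R, t \in `]- r, r[ -> y t = x t),
          (forall n : nat, \forall t \near (0 : R), derivable (derive1n n x) t 1) &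
          forall t : R, t \in `]- r, r[ ->
            (series (fun n : nat => (t ^+ n / n`!%:R) *: xi n) @ \oo --> x t) /\
            (series (fun n : nat => (t ^+ n / n`!%:R) *: derive1n n x 0) @ \oo
               --> x t)]].
Proof.
have [c [r0 [r0_gt0 cf]]] := nbhs_singleton f_analytic.
have [b [rw [rw_gt0 bw]]] := nbhs_singleton w_analytic.
have wb : power_series_on b rw w.
  by move=> t tr; have := bw t; rewrite subr0; apply.
pose rho := r0 / 2.
have rho0 : 0 < rho by rewrite divr_gt0.
have rhor0 : rho < r0 by rewrite ltr_pdivrMr// ltr_pMr// ltr1n.
have [M cM] : exists M, majorized c rho M.
  apply: (@analytic_majorized R d d c rho (f (z + const_mx rho)) (ltW rho0)).
  have zz : z + const_mx rho - z = const_mx rho by rewrite addrC addKr.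
  have := cf (z + const_mx rho); rewrite zz; apply.
  apply: le_lt_trans rhor0.
  by apply: ler_rV_norm (ltW rho0) _ => i; rewrite mxE gtr0_norm.
have M0 := majorized_ge0 cM.
pose a n := n`!%:R^-1 *: xi n.
have factK n : n`!%:R *: a n = xi n.
  by rewrite scalerA mulfV ?scale1r// pnatr_eq0 -lt0n fact_gt0.
have a0 : a 0%N = z by rewrite -xi_0 -[RHS]factK fact0 scale1r.
rewrite -a0 in cf.
have xiE : xi = fun n => n`!%:R *: a n by apply/funext => n; rewrite factK.
have ac : formal_solution c b a.
  move=> n; have := xi_rec n.
  have -> : gen_flow f (fun k : 'I_n.+1 => xi k) =
      n`!%:R *: comp_coef c (curve_poly a n) n.
    by rewrite -(gen_flow_comp_coef n rho0 rhor0 cM cf) xiE.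
  rewrite (power_series_taylor n rw_gt0 wb) -scalerDr -factK.
  rewrite factS natrM mulrC -scalerA => /scalerI; apply.
  by rewrite pnatr_eq0 -lt0n fact_gt0.
have [K [W [K0 W0 bW]]] := power_series_abs_bounded rw_gt0 wb.
have [e /= e0 eT] : exists2 e : R, 0 < e & ball (0 : R) e `<=` T.
  by apply/nbhs_ballP; exact: open_nbhs_nbhs.
(* The radius must stay within the discs where the series of [w] converges and
   is bounded, within [T], and satisfy the smallness condition of
   [formal_solution_bound] with [sigma = rho / 4]. *)
pose r := Num.min (Num.min K rw) (Num.min e (rho / 4 / (M + W + 1))).
have MW : 0 < M + W + 1 by rewrite ltr_wpDl// addr_ge0.
have rho4 : 0 < rho / 4 by rewrite divr_gt0.
have r_gt0 : 0 < r by rewrite !lt_min K0 rw_gt0 e0 divr_gt0.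
have rK : r <= K by rewrite !ge_min lexx.
have rrw : r <= rw by rewrite !ge_min lexx !orbT.
have re : r <= e by rewrite !ge_min lexx !orbT.
have rMW : r * (M + W) <= rho / 4.
  apply: (@le_trans _ _ (r * (M + W + 1))).
    by rewrite ler_wpM2l ?(ltW r_gt0)// lerDl.
  by rewrite -ler_pdivlMr// !ge_min lexx !orbT.
have r_ge0 := ltW r_gt0.
have rho4_le : rho / 4 <= rho by lra.
have aB := formal_solution_bound cM ac r_ge0 rho4_le (bW r r_ge0 rK) (ltW rho4) rMW.
have [x ax] : exists x, power_series_on a r x.
  apply: (@abs_bounded_power_series _ _ _ _ (`|a 0%N| + rho / 4)) => // -[|N].
    by rewrite big_geq// addr_ge0// ltW.
  by rewrite big_nat_recl// expr0 mulr1 lerD2l.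
have L0 : 0 <= M * 2 / rho by rewrite divr_ge0 ?mulr_ge0// ltW.
have fL := analytic_lipschitz rho0 rhor0 cM cf.
have wbr : power_series_on b r w by move=> t tr; apply: wb; exact: lt_le_trans rrw.
have ode := formal_solution_ode rho0 rhor0 cM ac cf r_gt0 aB wbr ax fL.
have itvE (t : R) : (t \in `]- r, r[) = (`|t| < r) by rewrite in_itv /= ltr_norml.
have xsol : ivp_solution f w z r x.
  split; first by rewrite (power_series_on_coef0 r_gt0 ax).
  by move=> t; rewrite itvE => /ode[].
exists r; split => //.
  move=> t /=; rewrite itvE => tr; apply: eT.
  by rewrite /ball /= sub0r normrN (lt_le_trans tr).
exists x; split => //.
- move=> y ysol; apply: (@ivp_unique R d f w z r (rho / 2) (M * 2 / rho)) => //.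
  + by rewrite divr_gt0.
  + by rewrite -a0.
  + move=> t; rewrite itvE => /ode[+ _]; rewrite -a0 => /le_lt_trans; apply; lra.
- move=> n; near=> t; apply: (power_series_derivable (power_series_derive1n (m := n) ax)).
  by near: t; apply: (cvgr_lt _ (@norm_continuous _ _ (0 : R))); rewrite normr0.
- have taylorE : (fun n : nat => derive1n n x 0) = xi.
    by apply/funext => n; rewrite (power_series_taylor n r_gt0 ax) factK.
  move=> t; rewrite itvE => /ax axt.
  have tE : (fun n : nat => (t ^+ n / n`!%:R) *: xi n) = (fun n => t ^+ n *: a n).
    by apply/funext => n; rewrite -scalerA.
  split; first by rewrite tE.
  rewrite (_ : (fun n : nat => _) = (fun n : nat => (t ^+ n / n`!%:R) *: xi n)).
    by rewrite tE.
  by apply/funext => n; rewrite -taylorE.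
Unshelve. all: by end_near. Qed.
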